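(* Let $\zeta$ be the character on the Hopf monoid of directed graphs $\mathbf{DG}$ defined on directed graphs $g$ by $$\zeta(g)=\begin{cases}1 & \text{if } g \text{ has no edges},\\ 0 & \text{otherwise},\end{cases}$$ and let $\chi_g(n)$ be the AA polynomial obtained from $\zeta$. Then for any directed graph $g$ (with finite vertex set) we have $$\chi_g(n)=\pi_g^{>}(n)\qquad\text{for all } n\in\mathbb{N}.$$
   Context: Fix a field $\mathbb{k}$. A directed graph $g=(I,E)$ with finite vertex set $I$ has a set $E\subseteq I\times I$ of directed edges (no parallel edges); $(u,v)$ denotes the edge from $u$ to $v$. Write $[n]=\{1,\dots,n\}$. Integers are viewed in $\mathbb{k}$ when compared with elements of $\mathbb{k}$. A decomposition $I=S_1\sqcup\cdots\sqcup S_n$ is an ordered $n$-tuple of pairwise disjoint, possibly empty subsets with union $I$. A subset $S\subseteq I$ is a lower half of $g$ if every directed edge connecting $S$ and $T=I\setminus S$ is oriented from $S$ to $T$, i.e. there is no edge $(u,v)\in E$ with $u\in T$, $v\in S$. For $S\subseteq I$, $g|_S$ is the induced subgraph on $S$ (all edges of $g$ with both ends in $S$). The Hopf monoid (in vector species) $\mathbf{DG}$: $\mathbf{DG}[I]$ is the $\mathbb{k}$-vector space with basis the directed graphs with vertex set $I$; bijections $I\to J$ act by relabeling vertices; for a decomposition $I=S\sqcup T$ the product $\mu_{S,T}:\mathbf{DG}[S]\otimes\mathbf{DG}[T]\to\mathbf{DG}[I]$ sends $g_1\otimes g_2$ to the disjoint union $g_1\cdot g_2$, and the coproduct $\Delta_{S,T}:\mathbf{DG}[I]\to\mathbf{DG}[S]\otimes\mathbf{DG}[T]$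 sends $g$ to $g|_S\otimes g|_T$ if $S$ is a lower half of $g$, and to $0$ otherwise. The higher coproducts $\Delta_{S_1,\dots,S_n}:\mathbf{DG}[I]\to\mathbf{DG}[S_1]\otimes\cdots\otimes\mathbf{DG}[S_n]$ are obtained by iterating the coproducts, $\Delta_{S_1,\dots,S_n}=(\Delta_{S_1,\dots,S_{n-1}}\otimes\mathrm{id})\circ\Delta_{S_1\sqcup\cdots\sqcup S_{n-1},\,S_n}$, with $\Delta_{I}=\mathrm{id}$ for $n=1$ (the result does not depend on the order of iteration). A character $\zeta$ is a family of linear maps $\zeta_I:\mathbf{DG}[I]\to\mathbb{k}$ that is invariant under relabeling, multiplicative ($\zeta_I(x\cdot y)=\zeta_S(x)\zeta_T(y)$), and sends the empty graph to $1$. The AA polynomial obtained from a character $\zeta$ is, for $x\in\mathbf{DG}[I]$ and $n\in\mathbb{N}$, $$\chi_x(n)=\sum_{I=S_1\sqcup\cdots\sqcup S_n}(\zeta_{S_1}\otimes\cdots\otimes\zeta_{S_n})\circ\Delta_{S_1,\dots,S_n}(x),$$ the sum being over all decompositions of $I$ into $n$ possibly empty parts (for $n=0$: $\chi_x(0)=\zeta_\emptyset(x)$ if $I=\emptyset$ and $0$ otherwise). The strict-chromatic polynomial of $g=(I,E)$ is $$\pi_g^{>}(n)=|\{f:I\to[n]\mid f(u)<f(v)\text{ for all }(u,v)\in E\}|.$$ *)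

(* Defs.v *)
From HB Require Import structures.
From mathcomp Require Import all_boot all_order all_algebra.

Set Implicit Arguments.
Unset Strict Implicit.
Unset Printing Implicit Defensive.

Import GRing.Theory.
Local Open Scope ring_scope.

(* Free modules on finite types.  The tensor product of the free modules on A *)
(* and B is represented by the free module on A * B, with e_a (x) e_b         *)
(* identified with e_(a, b); k (x) k is identified with k.                    *)
Notation freemod k B := {ffun B -> k^o}.

Definition basis (k : fieldType) (B : finType) (b : B) : freemod k B :=
  [ffun b' => (b' == b)%:R].

Definition linext (k : fieldType) (B : finType) (V : lmodType k) (f : B -> V)
  (x : freemod k B) : V := \sum_b (x b : k) *: f b.

Lemma linext_linear (k : fieldType) (B : finType) (V : lmodType k)
  (f : B -> V) : linear (linext f).
Proof.
move=> a x y; rewrite /linext scaler_sumr -big_split /=.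
by apply: eq_bigr => b _; rewrite !ffunE scalerDl scalerA.
Qed.

HB.instance Definition _ (k : fieldType) (B : finType) (V : lmodType k)
  (f : B -> V) :=
  GRing.isLinear.Build k (freemod k B) V _ (linext f) (linext_linear f).

Lemma linext_basis (k : fieldType) (B : finType) (V : lmodType k)
  (f : B -> V) (b : B) : linext f (basis k b) = f b.
Proof.
rewrite /linext (bigD1 b) //= ffunE eqxx scale1r big1 ?addr0 // => c cb.
by rewrite ffunE (negbTE cb) scale0r.
Qed.

Lemma linext_comp (k : fieldType) (B : finType) (V W : lmodType k)
  (h : {linear V -> W}) (f : B -> V) (x : freemod k B) :
  h (linext f x) = linext (h \o f) x.
Proof.
by rewrite /linext linear_sum; apply: eq_bigr => b _; rewrite linearZ.
Qed.

Definition tens (k : fieldType) (A B : finType)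
  (x : freemod k A) (y : freemod k B) : freemod k (A * B)%type :=
  [ffun p => (x p.1 : k) * (y p.2 : k)].

Definition tens_map (k : fieldType) (A A' B B' : finType)
  (f : {linear freemod k A -> freemod k A'})
  (g : {linear freemod k B -> freemod k B'}) :
  {linear freemod k (A * B)%type -> freemod k (A' * B')%type} :=
  linext (fun p : A * B => tens (f (basis k p.1)) (g (basis k p.2))).

Definition tens_form (k : fieldType) (A B : finType)
  (f : {linear freemod k A -> k^o}) (g : {linear freemod k B -> k^o}) :
  {linear freemod k (A * B)%type -> k^o} :=
  linext (fun p : A * B =>
    (f (basis k p.1) : k) * (g (basis k p.2) : k) : k^o).

(* The finite sets I on which the species is evaluated are the subsets of     *)
(* arbitrary finite types U, so that subsets of I are again of this form.     *)
Definition digraph (U : finType) (I : {set U}) :=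
  {E : {set U * U} | E \subset setX I I}.

Definition edges (U : finType) (I : {set U}) (g : digraph I) : {set U * U} :=
  val g.

Section GraphOperations.
Variables (U : finType).
Implicit Types (I S T : {set U}).

Lemma empty_subproof I : set0 \subset setX I I.
Proof. exact: sub0set. Qed.

Definition empty_digraph I : digraph I :=
  exist _ (set0 : {set U * U}) (empty_subproof I).

Lemma restrict_subproof I S (g : digraph I) :
  edges g :&: setX S S \subset setX S S.
Proof. exact: subsetIr. Qed.

Definition restrict I S (g : digraph I) : digraph S :=
  exist _ (edges g :&: setX S S) (restrict_subproof S g).

Lemma disjoint_union_subproof S T (g : digraph S) (h : digraph T) :
  edges g :|: edges h \subset setX (S :|: T) (S :|: T).
Proof.
rewrite subUset (subset_trans (valP g)) ?(subset_trans (valP h)) //.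
  by rewrite setXS // subsetUr.
by rewrite setXS // subsetUl.
Qed.

Definition disjoint_union S T (g : digraph S) (h : digraph T) :
  digraph (S :|: T) :=
  exist _ (edges g :|: edges h) (disjoint_union_subproof g h).

Definition lower_half I S (g : digraph I) : bool :=
  [forall u in I :\: S, forall v in S, (u, v) \notin edges g].

End GraphOperations.

Section Relabel.
Variables (U V : finType) (I : {set U}) (J : {set V}).
Variable s : {u | u \in I} -> {v | v \in J}.

Definition relabel_edges (g : digraph I) : {set V * V} :=
  [set (val (s p.1), val (s p.2)) | p : {u | u \in I} * {u | u \in I}
     & (val p.1, val p.2) \in edges g].

Lemma relabel_subproof (g : digraph I) :
  relabel_edges g \subset setX J J.
Proof.
by apply/subsetP=> _ /imsetP[p _ ->]; rewrite inE /= !(valP (s _)).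
Qed.

Definition relabel (g : digraph I) : digraph J :=
  exist _ (relabel_edges g) (relabel_subproof g).

End Relabel.

Section HopfMonoid.
Variable k : fieldType.

Notation DG I := (freemod k (digraph I)).

Definition DG_map (U V : finType) (I : {set U}) (J : {set V})
  (s : {u | u \in I} -> {v | v \in J}) : {linear DG I -> DG J} :=
  linext (fun g => basis k (relabel s g)).

Variable U : finType.
Implicit Types (I S T : {set U}).

Definition DG_mul S T :
  {linear freemod k (digraph S * digraph T)%type -> DG (S :|: T)} :=
  linext (fun p : digraph S * digraph T =>
    basis k (disjoint_union p.1 p.2)).

Definition DG_comul S T :
  {linear DG (S :|: T) -> freemod k (digraph S * digraph T)%type} :=
  linext (fun g : digraph (S :|: T) =>
    if lower_half S g then basis k (restrict S g, restrict T g) else 0).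

(* Iterated operations on S 0, ..., S m (m + 1 sets). *)
Fixpoint join (S : nat -> {set U}) (m : nat) : {set U} :=
  if m is m'.+1 then join S m' :|: S m'.+1 else S 0%N.

Fixpoint tens_basis (S : nat -> {set U}) (m : nat) : finType :=
  if m is m'.+1 then (tens_basis S m' * digraph (S m'.+1))%type
  else digraph (S 0%N).

Fixpoint DG_iter_comul (S : nat -> {set U}) (m : nat) :
  {linear DG (join S m) -> freemod k (tens_basis S m)} :=
  match m return {linear DG (join S m) -> freemod k (tens_basis S m)} with
  | 0 => (idfun : DG (S 0%N) -> DG (S 0%N))
  | m'.+1 =>
      tens_map (DG_iter_comul S m') (idfun : DG (S m'.+1) -> DG (S m'.+1))
        \o DG_comul (join S m') (S m'.+1)
  end.

Fixpoint tens_forms (z : forall I, {linear DG I -> k^o})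
  (S : nat -> {set U}) (m : nat) :
  {linear freemod k (tens_basis S m) -> k^o} :=
  match m return {linear freemod k (tens_basis S m) -> k^o} with
  | 0 => z (S 0%N)
  | m'.+1 => tens_form (tens_forms z S m') (z (S m'.+1))
  end.

End HopfMonoid.

Notation DG k I := (freemod k (digraph I)).

Record character (k : fieldType) := Character {
  char_form :> forall (U : finType) (I : {set U}), {linear DG k I -> k^o};
  char_relabel : forall (U V : finType) (I : {set U}) (J : {set V})
    (s : {u | u \in I} -> {v | v \in J}), bijective s ->
    forall x : DG k I, char_form J (DG_map k s x) = char_form I x;
  char_mul : forall (U : finType) (S T : {set U}), [disjoint S & T] ->
    forall (x : DG k S) (y : DG k T),
    char_form (S :|: T) (DG_mul k S T (tens x y)) =
      (char_form S x : k) * (char_form T y : k);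
  char_unit : forall U : finType,
    char_form set0 (basis k (empty_digraph (set0 : {set U}))) = 1
}.

Section Decompositions.
Variables (U : finType) (I : {set U}).

Definition is_decomposition n (s : n.-tuple {set U}) : bool :=
  [forall i, forall j, (i != j) ==> [disjoint tnth s i & tnth s j]]
  && (\bigcup_(i < n) tnth s i == I).

Definition decomposition n := {s : n.-tuple {set U} | is_decomposition s}.

Definition part n (D : decomposition n) (i : nat) : {set U} :=
  nth set0 (val D) i.

Lemma join_bigcup (S : nat -> {set U}) m :
  join S m = \bigcup_(i < m.+1) S i.
Proof.
elim: m => [|m IHm]; first by rewrite big_ord1.
by rewrite big_ord_recr /= IHm.
Qed.

Lemma join_part m (D : decomposition m.+1) : I = join (part D) m.
Proof.
have /andP[_ /eqP {1}<-] := valP D; rewrite join_bigcup.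
by apply: eq_bigr => i _; rewrite /part (tnth_nth set0).
Qed.

End Decompositions.

Definition DG_cast (k : fieldType) (U : finType) (I J : {set U})
  (e : I = J) (x : DG k I) : DG k J := ecast K (DG k K) e x.

Definition AA_polynomial (k : fieldType) (z : character k) (U : finType)
  (I : {set U}) (x : DG k I) (n : nat) : k :=
  match n with
  | 0 => if I == set0 then z U I x else 0
  | m.+1 => \sum_(D : decomposition I m.+1)
      (tens_forms (z U) (part D) m
        (DG_iter_comul k (part D) m (DG_cast (join_part D) x)) : k)
  end.

(* The colour set {1, ..., n} is represented by 'I_n = {0, ..., n - 1}.       *)
Definition strict_chromatic (U : finType) (I : {set U}) (g : digraph I)
  (n : nat) : nat :=
  #|[set f : {ffun {u | u \in I} -> 'I_n} |
      [forall u, forall v, ((val u, val v) \in edges g) ==> (f u < f v)%N]]|.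

Section EdgelessCharacter.
Variable k : fieldType.

Definition edgeless_form (U : finType) (I : {set U}) :
  {linear DG k I -> k^o} :=
  linext (fun g : digraph I => (if edges g == set0 then 1 else 0) : k^o).

Lemma relabel_edges_eq0 (U V : finType) (I : {set U}) (J : {set V})
  (s : {u | u \in I} -> {v | v \in J}) (g : digraph I) :
  (edges (relabel s g) == set0) = (edges g == set0).
Proof.
apply/idP/idP => /eqP g0; apply/eqP/setP=> -[u v]; rewrite inE.
  apply/negP=> uvg; have /setXP[uI vI] := subsetP (valP g) _ uvg.
  have := in_set0 (val (s (exist _ u uI)), val (s (exist _ v vI))).
  rewrite -g0 => /negP; apply; apply/imsetP.
  by exists (exist _ u uI, exist _ v vI); rewrite ?inE.
by apply/negP=> /imsetP[p]; rewrite inE g0 inE.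
Qed.

Lemma edgeless_relabel (U V : finType) (I : {set U}) (J : {set V})
  (s : {u | u \in I} -> {v | v \in J}) : bijective s ->
  forall x : DG k I, edgeless_form J (DG_map k s x) = edgeless_form I x.
Proof.
move=> _ x; rewrite (linext_comp (edgeless_form J)).
by apply: eq_bigr => g _; rewrite /= linext_basis relabel_edges_eq0.
Qed.

Lemma edgeless_mul (U : finType) (S T : {set U}) : [disjoint S & T] ->
  forall (x : DG k S) (y : DG k T),
  edgeless_form (S :|: T) (DG_mul k S T (tens x y)) =
    (edgeless_form S x : k) * (edgeless_form T y : k).
Proof.
move=> _ x y; rewrite (linext_comp (edgeless_form (S :|: T))) /linext.
rewrite mulr_suml; under [RHS]eq_bigr do rewrite mulr_sumr.
rewrite pair_bigA; apply: eq_bigr => -[g h] _ /=.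
rewrite linext_basis ffunE /edges /= setU_eq0 /GRing.scale /= mulrACA.
by case: (val g == set0); case: (val h == set0); rewrite ?mulr1 ?mulr0.
Qed.

Lemma edgeless_unit (U : finType) :
  edgeless_form set0 (basis k (empty_digraph (set0 : {set U}))) = 1.
Proof. by rewrite /= linext_basis eqxx. Qed.

Definition edgeless_character : character k :=
  Character edgeless_relabel edgeless_mul edgeless_unit.

Lemma edgeless_characterE (U : finType) (I : {set U}) (g : digraph I) :
  edgeless_character U I (basis k g) = if edges g == set0 then 1 else 0.
Proof. exact: linext_basis. Qed.

End EdgelessCharacter.

(* Main.v *)
(** Expanding the iterated coproduct, the summand of a decomposition is 1 when
    every edge goes from a part to a part of strictly larger index (lower halves
    forbid decreasing edges, the edgeless character forbids edges inside a
    part), and 0 otherwise.  Decompositions into n parts are the fibers of maps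
    to [n], so the sum counts the strict colourings. *)
Require Import Defs.
From mathcomp Require Import all_boot all_order all_algebra.

Set Implicit Arguments.
Unset Strict Implicit.
Unset Printing Implicit Defensive.

Import GRing.Theory.
Local Open Scope ring_scope.

Lemma freemod_sum_basis (k : fieldType) (A : finType) (x : freemod k A) :
  x = \sum_a (x a : k) *: basis k a.
Proof.
apply/ffunP=> a; rewrite sum_ffunE (bigD1 a) //= !ffunE eqxx big1 ?addr0.
  by rewrite /GRing.scale /= mulr1.
by move=> b /negbTE ba; rewrite !ffunE eq_sym ba scaler0.
Qed.

(** Bilinearity extends the defining values on basis pairs to all pure tensors. The iterated
    coproduct needs this, since its left factor need not be a basis vector. *)
Lemma tens_form_tens (k : fieldType) (A B : finType)
  (f : {linear freemod k A -> k^o}) (g : {linear freemod k B -> k^o})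
  (x : freemod k A) (y : freemod k B) :
  tens_form f g (tens x y) = (f x : k) * (g y : k).
Proof.
rewrite [in RHS](freemod_sum_basis x) [in RHS](freemod_sum_basis y) !linear_sum.
rewrite /= mulr_suml; under [RHS]eq_bigr do rewrite mulr_sumr.
rewrite pair_bigA /= /linext; apply: eq_bigr => -[a b] _ /=.
by rewrite ffunE (linearZ_LR f) (linearZ_LR g) /GRing.scale /= mulrACA.
Qed.

Section ColouredParts.
Variables (k : fieldType) (U : finType) (S : nat -> {set U}) (c : U -> nat).

Lemma join_colour_le m u :
    (forall i, (i <= m)%N -> {in S i, forall u, c u = i}) ->
  u \in join S m -> (c u <= m)%N.
Proof.
move=> cS; rewrite join_bigcup => /bigcupP[i _ ui].
have im : (i <= m)%N by rewrite -ltnS.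
by rewrite (cS i).
Qed.

(** Induction peels off the last part, whose vertices carry the top colour [m.+1] while those of
    [join S m] have colour at most [m]. The hypothesis on [c] also encodes disjointness of the
    parts. *)
Lemma tens_forms_iter_comul m (g : digraph (join S m)) :
    (forall i, (i <= m)%N -> {in S i, forall u, c u = i}) ->
  tens_forms (edgeless_character k U) S m (DG_iter_comul k S m (basis k g))
    = [forall p in edges g, (c p.1 < c p.2)%N]%:R.
Proof.
elim: m g => [|m IHm] g cS.
  rewrite [LHS]edgeless_characterE.
  suff ->: (edges g == set0) = [forall p in edges g, (c p.1 < c p.2)%N].
    by case: ifP.
  (* With a single part every colour is 0, so no edge can increase strictly. *)
  apply/eqP/forall_inP => [-> p|gP]; first by rewrite inE.
  apply/setP=> p; rewrite [RHS]inE; apply/negP=> pg.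
  have /setXP[p1 p2] : (p.1, p.2) \in setX (S 0%N) (S 0%N).
    by rewrite -surjective_pairing (subsetP (valP g)).
  by have := gP _ pg; rewrite !(cS 0%N).
have cS' : forall i, (i <= m)%N -> {in S i, forall u, c u = i}.
  by move=> i im; apply: cS; rewrite (leq_trans im).
have cJ u : u \in join S m -> (c u <= m)%N by apply: join_colour_le.
have cT u : u \in S m.+1 -> c u = m.+1 by apply: cS.
rewrite /= linext_basis.
case: ifP => [low|nlow]; last first.
  rewrite !linear0; case: forall_inP => // gP; case/negP: nlow.
  (* An edge from [S m.+1] back into [join S m] would decrease the colour. *)
  apply/forall_inP=> u; rewrite !inE => /andP[uJ uJT].
  apply/forall_inP=> v vJ; apply/negP=> /gP /=.
  by rewrite cT ?ltnNge ?(leqW (cJ v vJ)) //; case/orP: uJT uJ => // ->.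
rewrite linext_basis tens_form_tens /= IHm //.
rewrite linext_basis (_ : (if _ then _ else _) =
  (edges (restrict (S m.+1) g) == set0)%:R) -?natrM ?mulnb; last by case: ifP.
congr ((nat_of_bool _)%:R).
apply/andP/forall_inP => [[/forall_inP gJ /eqP gT] [u v] uvg /=|gP].
  have /setXP[] := subsetP (valP g) _ uvg; rewrite !inE.
  (* By position of the ends: edges inside [join S m] are covered by [gJ], edges into the last part
     increase automatically, [low] forbids edges out of it, and [gT] forbids edges inside it. *)
  case uJ: (u \in join S m); case vJ: (v \in join S m) => /= uT vT.
  - by apply: (gJ (u, v)); rewrite !inE uvg /= uJ vJ.
  - by rewrite (cT v) // ltnS cJ.
  - have /forall_inP/(_ u) := low; rewrite !inE uJ uT => /(_ isT).
    by move=> /forall_inP/(_ v vJ); rewrite uvg.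
  - by have := in_set0 (u, v); rewrite -gT !inE uvg /= uT vT.
split; first by apply/forall_inP=> p; rewrite inE => /andP[/gP].
apply/eqP/setP=> -[u v]; rewrite !inE /=; apply/negP => /and3P[/gP /= + uT vT].
by rewrite !cT // ltnn.
Qed.

(** Keeping [S] independent of [I] lets [e] be eliminated by substitution; for [S := part D] the
    right side of [e] would itself mention [I]. *)
Lemma tens_forms_iter_comul_cast m (I : {set U}) (e : I = join S m)
    (g : digraph I) :
    (forall i, (i <= m)%N -> {in S i, forall u, c u = i}) ->
  tens_forms (edgeless_character k U) S m
      (DG_iter_comul k S m (DG_cast e (basis k g)))
    = [forall p in edges g, (c p.1 < c p.2)%N]%:R.
Proof. by subst I; exact: tens_forms_iter_comul. Qed.

End ColouredParts.

Section Fibers.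
Variables (U : finType) (I : {set U}).

Definition fibers_tuple n (f : {ffun {u | u \in I} -> 'I_n}) :
  n.-tuple {set U} := [tuple [set val u | u in f @^-1: [set i]] | i < n].

Lemma mem_fibers_tuple n (f : {ffun {u | u \in I} -> 'I_n}) i u :
  (val u \in tnth (fibers_tuple f) i) = (f u == i).
Proof. by rewrite tnth_mktuple mem_imset ?inE //; exact: val_inj. Qed.

Lemma fibers_subproof n (f : {ffun {u | u \in I} -> 'I_n}) :
  is_decomposition I (fibers_tuple f).
Proof.
apply/andP; split.
  apply/forallP=> i; apply/forallP=> j; apply/implyP; apply: contraNT.
  rewrite -setI_eq0 => /set0Pn[x /setIP[]].
  rewrite {1}tnth_mktuple => /imsetP[u + ->].
  by rewrite mem_fibers_tuple !inE => /eqP->.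
apply/eqP/setP=> u; apply/bigcupP/idP => [[i _]|uI].
  by rewrite tnth_mktuple => /imsetP[v _ ->]; exact: valP.
by exists (f (exist _ u uI)) => //; rewrite (mem_fibers_tuple f _ (exist _ u uI)).
Qed.

Definition fibers n (f : {ffun {u | u \in I} -> 'I_n}) : decomposition I n :=
  exist _ (fibers_tuple f) (fibers_subproof f).

(** The default [ord0] is never reached, because the parts cover [I]. *)
Definition part_index m (D : decomposition I m.+1) :
    {ffun {u | u \in I} -> 'I_m.+1} :=
  [ffun u => odflt ord0 [pick i | val u \in tnth (val D) i]].

(** Covering gives a part containing [u], and disjointness makes it unique. *)
Lemma part_indexP m (D : decomposition I m.+1) i u :
  (val u \in tnth (val D) i) = (part_index D u == i).
Proof.
have /andP[/forallP disjD /eqP coverD] := valP D.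
rewrite ffunE; case: pickP => [j uj|no] /=.
  apply/idP/eqP => [ui|<- //]; apply/eqP; apply/negPn/negP => ji.
  have /forallP/(_ i)/implyP/(_ ji) := disjD j.
  by move=> /disjointFr/(_ uj); rewrite ui.
have : val u \in \bigcup_i tnth (val D) i by rewrite coverD; exact: valP.
by case/bigcupP=> j _; rewrite no.
Qed.

Lemma fibers_bij m : bijective (@fibers m.+1).
Proof.
exists (@part_index m) => [f|D].
  by apply/ffunP=> u; apply/eqP; rewrite -part_indexP mem_fibers_tuple.
apply/val_inj/eq_from_tnth => i; apply/setP=> u.
case: (boolP (u \in I)) => [uI|uI].
  by rewrite (mem_fibers_tuple _ _ (exist _ u uI)) -part_indexP.
(* Elements of [U] outside [I] lie in no part of either decomposition. *)
have out (E : decomposition I m.+1) : u \notin tnth (val E) i.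
  have /andP[_ /eqP/setP/(_ u) coverE] := valP E.
  by apply: contra uI => ui; rewrite -coverE; apply/bigcupP; exists i.
by rewrite !(negbTE (out _)).
Qed.

(** Extends [f] to all of [U]; the value 0 outside [I] is harmless, since edges and parts stay
    within [I]. *)
Definition colour n (f : {ffun {u | u \in I} -> 'I_n}) (u : U) : nat :=
  oapp (fun v => val (f v)) 0%N (insub u).

Lemma colour_val n (f : {ffun {u | u \in I} -> 'I_n}) u :
  colour f (val u) = f u.
Proof. by rewrite /colour valK. Qed.

Lemma colour_part m (f : {ffun {u | u \in I} -> 'I_m.+1}) i :
  (i <= m)%N -> {in part (fibers f) i, forall u, colour f u = i}.
Proof.
rewrite -ltnS => im u; rewrite /part -(tnth_nth set0 _ (Ordinal im)).
rewrite tnth_mktuple => /imsetP[v]; rewrite !inE => /eqP fv ->.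
by rewrite colour_val fv.
Qed.

Lemma colour_strict n (f : {ffun {u | u \in I} -> 'I_n}) (g : digraph I) :
  [forall p in edges g, (colour f p.1 < colour f p.2)%N]
  = [forall u, forall v, ((val u, val v) \in edges g) ==> (f u < f v)%N].
Proof.
apply/forall_inP/forallP => [gP u|gP [u v] uvg].
  by apply/forallP=> v; apply/implyP=> /gP; rewrite !colour_val.
have /setXP[uI vI] := subsetP (valP g) _ uvg.
have /forallP/(_ (exist _ v vI))/implyP/(_ uvg) := gP (exist _ u uI).
by rewrite -!colour_val.
Qed.

End Fibers.

(** Only the empty set maps to the empty colour set, and in exactly one way, vacuously strict. *)
Lemma strict_chromatic0 (U : finType) (I : {set U}) (g : digraph I) :
  strict_chromatic g 0 = (I == set0).
Proof.
rewrite /strict_chromatic; case: eqP => [I0|/eqP/set0Pn[u uI]].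
  have noI (u : {u | u \in I}) : False by case: u => u; rewrite I0 inE.
  rewrite (_ : [set _ | _] = setT) ?cardsT ?card_ffun ?card_ord.
    by rewrite (eq_card0 (fun u => False_ind _ (noI u))).
  by apply/setP=> f; rewrite !inE; apply/forallP=> u; case: (noI u).
by apply: eq_card0 => f; case: (f (exist _ u uI)).
Qed.

Theorem theorem1p2 (k : fieldType) (U : finType) (I : {set U})
  (g : digraph I) (n : nat) :
  AA_polynomial (edgeless_character k) (basis k g) n
    = ((strict_chromatic g n)%:R)%R :> k.
Proof.
case: n => [|m].
  rewrite strict_chromatic0 /AA_polynomial; case: eqP => // I0.
  rewrite edgeless_characterE (_ : edges g == set0) // -subset0.
  apply/subsetP=> p /(subsetP (valP g)).
  by rewrite [in X in X -> _]I0 !inE.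
(* The sum now runs over all maps [f]; the count is likewise written as a sum of indicators, and the
   two agree term by term. *)
rewrite /AA_polynomial (reindex _ (onW_bij _ (fibers_bij I m))) /=.
rewrite /strict_chromatic -sum1_card natr_sum [RHS]big_mkcond /=.
apply: eq_bigr => f _.
rewrite (tens_forms_iter_comul_cast _ _ _ (@colour_part _ _ _ f)) colour_strict.
by rewrite inE; case: ifP.
Qed.
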